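(* Let $G$ be a square and let $H$ be any graph. Then the strong product $G\boxtimes H$ is a square.
   Context: $G\boxtimes H$ has vertex set $V(G)\times V(H)$, with $(g,h)$ adjacent to $(g',h')$ iff one of the following holds: $g=g'$ and $hh'\in E(H)$; $h=h'$ and $gg'\in E(G)$; $gg'\in E(G)$ and $hh'\in E(H)$. All graphs are finite, simple, with nonempty vertex sets. A partially labeled graph is a graph $K$ together with an injective map $\theta: L\to V(K)$, $L\subseteq\mathbb{N}$, whose image $\theta(L)$ is nonempty and a proper subset of $V(K)$; vertices in $\theta(L)$ are labeled. The square $KK$ is obtained from two disjoint copies of $K$ by identifying each labeled vertex $\theta(\ell)$ of the first copy with $\theta(\ell)$ of the second copy (keeping all edges, merging double edges). A graph is a square if it is isomorphic to $KK$ for some partially labeled graph $K$. *)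

(* Defs.v *)
From HB Require Import structures.
From mathcomp Require Import all_boot finmap.
From mathcomp Require Import generic_quotient.

Set Implicit Arguments.
Unset Strict Implicit.
Unset Printing Implicit Defensive.

Local Open Scope quotient_scope.

Record graph := Graph {
  vertex :> finType;
  adj : rel vertex;
  adj_sym : symmetric adj;
  adj_irr : irreflexive adj;
  vertex_gt0 : 0 < #|vertex|
}.

Definition graph_iso (G H : graph) : Prop :=
  exists2 f : G -> H, bijective f & {mono f : x y / adj x y}.

Section StrongProduct.
Variables G H : graph.

Definition strong_adj : rel (G * H)%type := fun p q =>
  [|| (p.1 == q.1) && adj p.2 q.2,
      (p.2 == q.2) && adj p.1 q.1
    | adj p.1 q.1 && adj p.2 q.2].

Lemma strong_adj_sym : symmetric strong_adj.
Proof.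
move=> p q; rewrite /strong_adj (eq_sym p.1) (eq_sym p.2).
by rewrite (adj_sym p.1) (adj_sym p.2).
Qed.

Lemma strong_adj_irr : irreflexive strong_adj.
Proof. by move=> p; rewrite /strong_adj !adj_irr !andbF. Qed.

Lemma strong_gt0 : 0 < #|{: G * H}|.
Proof. by rewrite card_prod muln_gt0 !vertex_gt0. Qed.

Definition strong_product : graph :=
  Graph strong_adj_sym strong_adj_irr strong_gt0.

End StrongProduct.

(* The label set is a finite set of naturals: as [lab] is injective into the  *)
(* finite vertex set, no infinite label set is possible.                      *)
Record plgraph := PLGraph {
  pl_graph :> graph;
  labels : {fset nat};
  lab : labels -> pl_graph;
  lab_inj : injective lab;
  lab_neq0 : [set lab l | l : labels] != set0;
  lab_proper : [set lab l | l : labels] \proper [set: pl_graph]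
}.

Section Square.
Variable K : plgraph.

(* [inl v] and [inr v] are the vertex [v] in the first and second copy of K.  *)
Definition copies_adj : rel (K + K)%type := fun x y =>
  match x, y with
  | inl u, inl v => adj u v
  | inr u, inr v => adj u v
  | _, _ => false
  end.

Definition identified : rel (K + K)%type := fun x y =>
  (x == y) || [exists l : labels K,
     ((x == inl (lab l)) && (y == inr (lab l)))
  || ((x == inr (lab l)) && (y == inl (lab l)))].

Lemma identified_refl : reflexive identified.
Proof. by move=> x; rewrite /identified eqxx. Qed.

Lemma identified_sym : symmetric identified.
Proof.
move=> x y; rewrite /identified eq_sym; congr orb.
by apply: eq_existsb => l; rewrite orbC; congr orb; rewrite andbC.
Qed.

Lemma identified_trans : transitive identified.
Proof.
move=> y x z /orP[/eqP->//|Hxy] /orP[/eqP<-|].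
  by rewrite /identified Hxy orbT.
case/existsP: Hxy => l /orP[] /andP[/eqP-> /eqP->] /existsP[m].
  case/orP=> /andP[/eqP E /eqP->]; first by [].
  by case: E => ->; apply: identified_refl.
case/orP=> /andP[/eqP E /eqP->]; last by [].
by case: E => ->; apply: identified_refl.
Qed.

Canonical identified_equiv :=
  EquivRel identified identified_refl identified_sym identified_trans.

Definition square_vertex := {eq_quot identified}.
HB.instance Definition _ := EqQuotient.on square_vertex.
HB.instance Definition _ := Countable.on square_vertex.

Lemma square_enumP :
  Finite.axiom (undup [seq \pi_square_vertex x | x <- enum {: K + K}]).
Proof.
move=> p; rewrite count_uniq_mem ?undup_uniq // mem_undup -[p]reprK.
by rewrite map_f ?mem_enum.
Qed.

HB.instance Definition _ := isFinite.Build square_vertex square_enumP.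

Definition square_adj : rel square_vertex := fun p q =>
  [exists x : K + K, exists y : K + K,
    [&& \pi_square_vertex x == p, \pi_square_vertex y == q & copies_adj x y]].

Lemma square_adj_sym : symmetric square_adj.
Proof.
suff sub p q : square_adj p q -> square_adj q p.
  by move=> p q; apply/idP/idP; apply: sub.
case/existsP=> x /existsP[y /and3P[xp yq xy]].
apply/existsP; exists y; apply/existsP; exists x; rewrite yq xp /=.
by case: x y {xp yq} xy => u [] v //=; rewrite adj_sym.
Qed.

Lemma square_adj_irr : irreflexive square_adj.
Proof.
move=> p; apply/negbTE/negP => /existsP[x /existsP[y /and3P[/eqP<- /eqP/eqmodP xy]]].
case/orP: xy => [/eqP->|/existsP[l /orP[]/andP[/eqP-> /eqP->]//]].
by case: x => u /=; rewrite adj_irr.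
Qed.

Lemma square_gt0 : 0 < #|{: square_vertex}|.
Proof.
have /card_gt0P[v _] := vertex_gt0 K.
by apply/card_gt0P; exists (\pi_square_vertex (inl v)).
Qed.

Definition square : graph := Graph square_adj_sym square_adj_irr square_gt0.

End Square.

Definition is_square (G : graph) : Prop :=
  exists K : plgraph, graph_iso G (square K).

(* Main.v *)
(** A graph is a square iff it is covered by two copies of a graph [K] that meet
    exactly in a set [S] of vertices (nonempty and proper), all edges lying
    inside a copy.  If [G] is covered in this way by two copies of [K] meeting
    in [S], then [G ⊠ H] is covered by two copies of [K ⊠ H] meeting in
    [S × H]: two adjacent vertices of [G ⊠ H] have equal or adjacent first
    coordinates, which therefore lie in a common copy of [K]. *)

Require Import Defs.
From mathcomp Require Import all_boot finmap generic_quotient.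

Set Implicit Arguments.
Unset Strict Implicit.
Unset Printing Implicit Defensive.

Local Open Scope quotient_scope.

(* [i false] and [i true] are the embeddings of the two copies of [K]. *)
Record doubling (K : graph) (S : {set K}) (X : graph) (i : bool -> K -> X) :=
  Doubling {
    doubling_eq : forall b c u v,
      i b u = i c v <-> u = v /\ (b = c \/ u \in S);
    doubling_surj : forall p, exists b u, i b u = p;
    doubling_adj : forall p q,
      adj p q <-> exists b u v, [/\ i b u = p, i b v = q & adj u v]
  }.

Section LabeledBySet.
Variables (K : graph) (S : {set K}).
Hypotheses (S_neq0 : S != set0) (S_proper : S \proper [set: K]).

(** Labels must be natural numbers, so the vertices of [S] are labeled by their positions in the
    enumeration of [S]. *)
Definition set_labels : {fset nat} := seq_fset tt (iota 0 #|S|).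

Lemma set_label_lt (l : set_labels) : val l < #|S|.
Proof. by have := valP l; rewrite seq_fsetE mem_iota. Qed.

Definition set_lab (l : set_labels) : K := enum_val (Ordinal (set_label_lt l)).

Lemma set_lab_inj : injective set_lab.
Proof. by move=> l m /enum_val_inj [] /val_inj. Qed.

Lemma set_lab_im : [set set_lab l | l : set_labels] = S.
Proof.
apply/setP => x; apply/imsetP/idP => [[l _ ->]|xS]; first exact: enum_valP.
(* The label of [x] is its rank in the enumeration of [S]. *)
have lP : val (enum_rank_in xS x) \in set_labels.
  by rewrite seq_fsetE mem_iota /= add0n ltn_ord.
exists [` lP]%fset => //; rewrite /set_lab -[LHS](enum_rankK_in xS xS).
by congr enum_val; apply: val_inj.
Qed.

Lemma set_lab_neq0 : [set set_lab l | l : set_labels] != set0.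
Proof. by rewrite set_lab_im. Qed.

Lemma set_lab_proper : [set set_lab l | l : set_labels] \proper [set: K].
Proof. by rewrite set_lab_im. Qed.

Definition label_set : plgraph :=
  PLGraph set_lab_inj set_lab_neq0 set_lab_proper.

End LabeledBySet.

Section SquareDoubling.
Variable K : plgraph.

Definition in_copy (b : bool) (u : K) : K + K := if b then inr u else inl u.

Definition square_emb (b : bool) (u : K) : square K :=
  \pi_(square_vertex K) (in_copy b u).

Lemma in_copyP (x : K + K) : exists b u, x = in_copy b u.
Proof. by case: x => u; [exists false, u | exists true, u]. Qed.

(** Two distinct points of the disjoint union are identified only if they are the two copies of one
    labeled vertex. *)
Lemma square_emb_eq b c u v :
  square_emb b u = square_emb c v <->
  u = v /\ (b = c \/ u \in [set lab l | l : labels K]).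
Proof.
split=> [/eqmodP /orP[/eqP|/existsP[l]]|[<- [<-//|/imsetP[l _ ->]]]].
- by case: b c => [] [] // [->]; split=> //; left.
- have lP : lab l \in [set lab l | l : labels K] by apply: imset_f.
  by case: b c => [] [] /orP[] // /andP[/eqP // [->] /eqP // [->]]; split=> //; right.
apply/eqmodP; rewrite /= /identified; case: eqP => //= neq.
by apply/existsP; exists l; case: b c neq => [] [] //= _; rewrite !eqxx ?orbT.
Qed.

Lemma square_doubling : doubling [set lab l | l : labels K] square_emb.
Proof.
split=> [|p|p q]; first exact: square_emb_eq.
  by have [b [u E]] := in_copyP (repr p); exists b, u; rewrite /square_emb -E reprK.
split=> [/existsP[x /existsP[y /and3P[/eqP<- /eqP<-]]]|[b [u [v [<- <- uv]]]]].
  by case: x y => u [] v //= uv; [exists false, u, v | exists true, u, v].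
apply/existsP; exists (in_copy b u); apply/existsP; exists (in_copy b v).
by rewrite !eqxx; case: b.
Qed.

End SquareDoubling.

Lemma iso_doubling (K : graph) (S : {set K}) (X Y : graph)
    (i : bool -> K -> Y) (f : X -> Y) (g : Y -> X) :
  cancel f g -> cancel g f -> {mono f : x y / adj x y} ->
  doubling S i -> doubling S (fun b u => g (i b u)).
Proof.
move=> fK gK fM [ieq isurj iadj]; split=> [b c u v|p|p q].
- by rewrite -ieq; split=> [/(can_inj gK)|->].
- by have [b [u E]] := isurj (f p); exists b, u; rewrite E fK.
rewrite -fM iadj; split=> -[b [u [v [Ep Eq uv]]]]; exists b, u, v.
  by rewrite Ep Eq !fK.
by rewrite -Ep -Eq !gK.
Qed.

(** Both the coincidences among the [i b u] and the edges between them are dictated by [K] and [S]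
    alone, so sending [i b u] to [j b u] is a well-defined isomorphism. *)
Lemma doubling_iso (K : graph) (S : {set K}) (X Y : graph)
    (i : bool -> K -> X) (j : bool -> K -> Y) :
  doubling S i -> doubling S j -> graph_iso X Y.
Proof.
move=> Di Dj.
(* Choose a copy and a preimage for each vertex; over [S] the choice of copy is arbitrary. *)
have chart (Z : graph) (k : bool -> K -> Z) : doubling S k ->
    exists s : Z -> bool * K, forall p, k (s p).1 (s p).2 = p.
  move=> Dk; have ex p : exists bu : bool * K, k bu.1 bu.2 == p.
    by have [b [u E]] := doubling_surj Dk p; exists (b, u); rewrite E.
  by exists (fun p => xchoose (ex p)) => p; apply/eqP/(xchooseP (ex p)).
have [s sK] := chart _ _ Di; have [t tK] := chart _ _ Dj.
pose f p := j (s p).1 (s p).2; pose g q := i (t q).1 (t q).2.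
(* Independence of the choice: [i] and [j] have the same criterion for equality of images. *)
have fi b u : f (i b u) = j b u.
  by apply/(doubling_eq Dj)/(doubling_eq Di); rewrite sK.
have gj b u : g (j b u) = i b u.
  by apply/(doubling_eq Di)/(doubling_eq Dj); rewrite tK.
have fK : cancel f g by move=> p; rewrite -[p]sK fi gj.
have gK : cancel g f by move=> q; rewrite -[q]tK gj fi.
exists f; first by exists g.
move=> p q; apply/idP/idP => [/(doubling_adj Dj)|/(doubling_adj Di)].
  move=> [b [u [v [Ep Eq uv]]]]; apply/(doubling_adj Di); exists b, u, v.
  by rewrite -!gj Ep Eq !fK.
move=> [b [u [v [<- <- uv]]]]; apply/(doubling_adj Dj); exists b, u, v.
by rewrite !fi.
Qed.

(** This trades the quotient and the labels for a covering by two copies, which is easier to carry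
    through the product. *)
Lemma is_squareP (X : graph) :
  is_square X <->
  exists (K : graph) (S : {set K}) (i : bool -> K -> X),
    [/\ S != set0, S \proper [set: K] & doubling S i].
Proof.
split=> [[K [f [g fK gK] fM]]|[K [S [i [S0 ST Di]]]]].
  exists K, [set lab l | l : labels K], (fun b u => g (square_emb b u)).
  split; [exact: lab_neq0 | exact: lab_proper |].
  exact: iso_doubling fK gK fM (square_doubling K).
exists (label_set S0 ST).
(* The labeled vertices are exactly [S], so [X] and this square double the same pair. *)
have := square_doubling (label_set S0 ST); rewrite set_lab_im.
exact: doubling_iso Di.
Qed.

Lemma strong_doubling (K : graph) (S : {set K}) (G H : graph)
    (i : bool -> K -> G) :
  doubling S i ->
  @doubling (strong_product K H) (setX S [set: H]) (strong_product G H)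
    (fun b p => (i b p.1, p.2)).
Proof.
move=> [ieq isurj iadj].
have iinj b u v : i b u = i b v -> u = v by case/ieq.
have iM b u v : adj u v -> adj (i b u) (i b v).
  by move=> uv; apply/iadj; exists b, u, v.
split=> [b c [u h] [v k]|[p h]|[p h] [q k]] /=.
- rewrite !inE andbT; split=> [[/ieq[-> bc] ->]|[[-> ->] bc]] //.
  by congr pair; apply/ieq.
- by have [b [u <-]] := isurj p; exists b, (u, h).
split=> [/or3P[]/andP[]/=|[b [[u h'] [[v k'] /= [[<- <-] [<- <-]]]]]].
(* Equal first coordinates: any copy containing [p] will do. In the next two cases the copy is one
   containing the edge [pq] of [G]. *)
- move=> /eqP<- hk; have [b [u <-]] := isurj p.
  by exists b, (u, h), (u, k); split=> //; rewrite /strong_adj /= eqxx hk.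
- move=> /eqP<- /iadj[b [u [v [<- <- uv]]]].
  by exists b, (u, h), (v, h); split=> //; rewrite /strong_adj /= eqxx uv orbT.
- move=> /iadj[b [u [v [<- <- uv]]]] hk.
  by exists b, (u, h), (v, k); split=> //; rewrite /strong_adj /= uv hk !orbT.
(* Conversely, [i b] preserves edges, so each of the three kinds of adjacency goes to the same
   kind. *)
case/or3P=> /andP[] /= => [/eqP-> E|/eqP-> /(iM b) E|/(iM b) E E'];
  by rewrite /strong_adj /= ?eqxx ?E ?E' ?orbT.
Qed.

Theorem theorem5p6 (G H : graph) :
  is_square G -> is_square (strong_product G H).
Proof.
move=> /is_squareP[K [S [i [/set0Pn[s sS] /properP[_ [t _ tS]] Di]]]].
(* With a vertex [h] of [H], the pair [(s, h)] lies in [S × H] and [(t, h)] lies outside it. *)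
have /card_gt0P[h _] := vertex_gt0 H.
apply/is_squareP; exists (strong_product K H), (setX S [set: H]).
exists (fun b p => (i b p.1, p.2)); split; last exact: strong_doubling.
  by apply/set0Pn; exists (s, h); rewrite !inE sS.
rewrite properE subsetT; apply/subsetPn; exists (t, h); rewrite !inE //.
by rewrite (negbTE tS).
Qed.
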